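(* Let $f:2^V\to\mathbb{R}_{\ge0}$ be monotone submodular with $f(\{v\})>0$ for all $v\in V$, let $k,W\ge1$ be integers, let $\epsilon\in(0,1)$, and let $v_1,v_2,\dots$ be a stream of elements of $V$. Let $L$ be an upper bound on the time for each evaluation of $f$, and $\Phi=\max_{v\in V}f(\{v\})/\min_{v\in V}f(\{v\})$. Then the Submodular Smooth Histograms algorithm (described in the context) with $\beta=\delta=\epsilon/2$ has an update time of $O(L\log^2(k\Phi)/\epsilon^2)$ per element and uses memory (number of stored elements) $O(k\log^2(k\Phi)/\epsilon^2)$.
   Context: Notation: $f'_S(v)=f(S\cup\{v\})-f(S)$; $\Delta=\max_{v\in V}f(\{v\})$. Algorithm $\mathsf{StreamAllThresholds}$ with parameter $\delta$ on a stream $u_1,u_2,\dots$: let $m=\lfloor\log_{1+\delta}(2k\Delta/f(\{u_1\}))\rfloor$ and $T=\{(1+\delta)^jf(\{u_1\})/(2k): j=0,\dots,m\}$; for each $\tau\in T$ keep $S_\tau$, initially empty; upon arrival of $u_t$, for each $\tau\in T$, if $f'_{S_\tau}(u_t)\ge\tau$ and $|S_\tau|<k$, add $u_t$ to $S_\tau$; its current output is $\max_{\tau\in T}f(S_\tau)$. For $a\le b$, $h(a,b)$ is the output of $\mathsf{StreamAllThresholds}$ run on $v_a,\dots,v_b$. Submodular Smooth Histograms algorithm (parameters $\beta,\delta,W$): it maintains indices $x_1<\dots<x_s$ (initially $s=0$), each with a running instance of $\mathsf{StreamAllThresholds}$ (parameter $\delta$) on the substream starting at $v_{x_i}$, whose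 output after processing $v_t$ is $h(x_i,t)$. At each time $t=1,2,\dots$: (1) set $s\leftarrow s+1$, $x_s\leftarrow t$, start a new instance starting at $v_t$; (2) for each $1\le i<s$, if $x_{i+1}<t-W+1$, remove $x_i$ and its instance (re-index, $s\leftarrow s-1$); (3) pass $v_t$ to all instances; (4) while there exists $1\le i\le s-2$ with $h(x_{i+2},t)\ge(1-\beta)h(x_i,t)$, remove $x_{i+1}$ and its instance (re-index, $s\leftarrow s-1$); (5) output $\mathsf{Solution}_t=h(x_1,t)$ if $x_1=\max(1,t-W+1)$, otherwise $h(x_2,t)$. *)

(* Defs.v *)
From HB Require Import structures.
From mathcomp Require Import all_boot all_order all_algebra.
From mathcomp Require boolp.
From mathcomp Require Import reals exp.

Set Implicit Arguments.
Unset Strict Implicit.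
Unset Printing Implicit Defensive.

Import Order.TTheory GRing.Theory Num.Theory.
Local Open Scope ring_scope.

(* A computation returning a value together with its running time. *)
Definition timed (A : Type) : Type := (A * nat)%type.

Definition ret (A : Type) (a : A) : timed A := (a, 0%N).

Definition tick (n : nat) : timed unit := (tt, n).

Definition bind (A B : Type) (m : timed A) (g : A -> timed B) : timed B :=
  ((g m.1).1, (m.2 + (g m.1).2)%N).

Notation "'let!' x := m 'in' b" := (bind m (fun x => b))
  (at level 200, x binder, m at level 200, b at level 200,
   format "'[v' 'let!'  x  :=  m  'in' '/' b ']'").

Fixpoint traverse (A B : Type) (g : A -> timed B) (s : seq A) :
    timed (seq B) :=
  if s is x :: s' then
    let! y := g x in
    let! r := traverse g s' in
    ret (y :: r)
  else ret [::].

Section SetFunction.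
Variables (R : realType) (V : finType) (f : {set V} -> R).

Definition marginal (S : {set V}) (v : V) : R := f (v |: S) - f S.

Definition monotone : Prop :=
  forall A B : {set V}, A \subset B -> f A <= f B.

Definition submodular : Prop :=
  forall (A B : {set V}) (v : V),
    A \subset B -> v \notin B -> marginal B v <= marginal A v.

(* The default values of the two iterated operators are harmless: f is
   nonnegative, and the minimum is at most the maximum. *)
Definition Delta : R := \big[Num.max/0]_(v : V) f [set v].

Definition min_singleton : R := \big[Num.min/Delta]_(v : V) f [set v].

Definition Phi : R := Delta / min_singleton.

End SetFunction.

Section StreamAllThresholds.
Variables (R : realType) (V : finType) (f : {set V} -> R).
(* [eval_time S] is the time taken by one evaluation of f at S.  Every other
   elementary operation (arithmetic operation, comparison, insertion or
   deletion in a list) takes one unit of time. *)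
Variable eval_time : {set V} -> nat.
Variables (k : nat) (delta : R).

(* The pairs (tau, S_tau), tau ranging over T. *)
Definition candidates : Type := seq (R * {set V}).

Definition evaluate (S : {set V}) : timed R := (f S, eval_time S).

Definition eval_marginal (S : {set V}) (v : V) : timed R :=
  let! a := evaluate (v |: S) in
  let! b := evaluate S in
  let! _ := tick 1 in
  ret (a - b).

(* The threshold set T depends on the first element u of the stream; one unit
   of time is charged for m and one for each of the m + 1 thresholds.  Since
   f [set u] <= Delta, the logarithm is nonnegative, so that truncation is the
   floor. *)
Definition sat_new (u : V) : timed candidates :=
  let! a := evaluate [set u] in
  let m := Num.truncn (ln (2 * k%:R * Delta f / a) / ln (1 + delta)) in
  let! _ := tick m.+2 in
  ret [seq ((1 + delta) ^+ j * a / (2 * k%:R), set0) | j <- iota 0 m.+1].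

Definition sat_feed1 (u : V) (p : R * {set V}) : timed (R * {set V}) :=
  let! d := eval_marginal p.2 u in
  let! _ := tick 2 in
  if (p.1 <= d) && (#|p.2| < k)%N then
    let! _ := tick 1 in ret (p.1, u |: p.2)
  else ret p.

Definition sat_feed (u : V) (c : candidates) : timed candidates :=
  traverse (sat_feed1 u) c.

(* The maximum of f (S_tau); as f is nonnegative and T is nonempty, starting
   the maximum at 0 does not change its value. *)
Fixpoint sat_output (c : candidates) : timed R :=
  if c is p :: c' then
    let! a := evaluate p.2 in
    let! b := sat_output c' in
    let! _ := tick 1 in
    ret (Num.max a b)
  else ret 0.

End StreamAllThresholds.

Section SmoothHistogram.
Variables (R : realType) (V : finType) (f : {set V} -> R).
Variable eval_time : {set V} -> nat.
Variables (k W : nat) (beta delta : R).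
(* The stream is v 1, v 2, ...; v 0 is never read. *)
Variable v : nat -> V.

(* (x_i, the running StreamAllThresholds started at v x_i) *)
Definition instance : Type := (nat * candidates R V)%type.

(* Listed by increasing i. *)
Definition state : Type := seq instance.

(* An instance together with its current output h(x_i, t), which is computed
   once per update. *)
Definition instance_out : Type := (instance * R)%type.

Definition arrive (t : nat) (st : state) : timed state :=
  let! c := sat_new f eval_time k delta (v t) in
  let! _ := tick 1 in
  ret (rcons st (t, c)).

(* x_(i+1) < t - W + 1 is written without truncated subtraction. *)
Fixpoint expire (t : nat) (st : state) : timed state :=
  if st is x :: st' then
    if st' is y :: _ then
      let! r := expire t st' in
      let! _ := tick 2 in
      ret (if (y.1 + W < t + 1)%N then r else x :: r)
    else ret st
  else ret st.

Definition pass1 (t : nat) (x : instance) : timed instance_out :=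
  let! c := sat_feed f eval_time k (v t) x.2 in
  let! h := sat_output f eval_time c in
  ret ((x.1, c), h).

Definition pass (t : nat) (st : state) : timed (seq instance_out) :=
  traverse (pass1 t) st.

Definition removal (s s' : seq instance_out) : Prop :=
  exists (l r : seq instance_out) (x y z : instance_out),
    [/\ s = l ++ [:: x, y, z & r],
        (1 - beta) * x.2 <= z.2
      & s' = l ++ [:: x, z & r]].

(* The while loop, with any choice of the index to remove at each iteration;
   the last argument is the time spent.  Each test of the guard is charged a
   multiplication and a comparison for every i <= s - 2, and each removal is
   charged s for re-indexing. *)
Inductive prune : seq instance_out -> seq instance_out -> nat -> Prop :=
| prune_stop s :
    (forall s', ~ removal s s') -> prune s s (2 * (size s - 2))
| prune_loop s s' s'' n :
    removal s s' -> prune s' s'' n ->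
    prune s s'' (2 * (size s - 2) + size s + n).

(* The truncated t + 1 - W agrees with t - W + 1 inside the maximum.  The
   default value of [head] is never used: if the first index is not the start
   of the window then a second instance exists. *)
Definition solution (t : nat) (s : seq instance_out) : timed R :=
  if s is x :: r then
    let! _ := tick 2 in
    ret (if x.1.1 == maxn 1 (t + 1 - W) then x.2 else head x.2 (map snd r))
  else ret 0.

(* The number of stored elements, counted with multiplicity. *)
Definition stored (st : state) : nat :=
  (\sum_(x <- st) \sum_(p <- x.2) #|p.2|)%N.

Record outcome := Outcome {
  next_state : state;
  answer : R;
  update_time : nat;
  peak_memory : nat
}.

(* Processing of v t.  Within each of the steps the number of stored elements
   is monotone, so its peak is attained between two steps. *)
Inductive update (t : nat) (st : state) : outcome -> Prop :=
| Update (pruned : seq instance_out) (n : nat) :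
    let arrived := arrive t st in
    let alive := expire t arrived.1 in
    let passed := pass t alive.1 in
    let sol := solution t pruned in
    prune passed.1 pruned n ->
    update t st
      {| next_state := map fst pruned;
         answer := sol.1;
         update_time := arrived.2 + alive.2 + passed.2 + n + sol.2;
         peak_memory :=
           maxn (maxn (stored st) (stored arrived.1))
             (maxn (stored alive.1)
                (maxn (stored (map fst passed.1))
                   (stored (map fst pruned)))) |}.

(* [run t st]: st is a possible state after v 1, ..., v t. *)
Inductive run : nat -> state -> Prop :=
| run_nil : run 0 [::]
| run_next t st o : run t st -> update t.+1 st o -> run t.+1 (next_state o).

(* The while loop always terminates, so updates never get stuck. *)
Lemma prune_total (s : seq instance_out) : exists s' n, prune s s' n.
Proof.
have [m] := ubnP (size s); elim: m s => // m IHm s lt_s_m.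
have [[s' rem_s]|no_rem] := boolp.pselect (exists s', removal s s'); last first.
  exists s, (2 * (size s - 2))%N; apply: prune_stop => s' rem_s.
  by apply: no_rem; exists s'.
have lt_s's : (size s' < size s)%N.
  case: rem_s => l [r [x [y [z [-> _ ->]]]]].
  by rewrite !size_cat /= ltn_add2l.
have [s'' [n pr]] := IHm s' (leq_trans lt_s's lt_s_m).
by exists s'', (2 * (size s - 2) + size s + n)%N; apply: prune_loop pr.
Qed.

Lemma update_total (t : nat) (st : state) : exists o, update t st o.
Proof.
have [s [n pr]] := prune_total (pass t (expire t (arrive t st).1).1).1.
by eexists; apply: Update pr.
Qed.

End SmoothHistogram.

(* Main.v *)
(** After the while loop the outputs satisfy h(x_(i+2)) < (1 - beta) h(x_i).
    Every output lies between min f({v}) / 2 and k Delta: the upper bound is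
    submodularity, the lower one holds as soon as an instance has processed its
    first element.  The two bounds have ratio 2 k Phi, so O(log(k Phi) / eps)
    instances survive, each with O(log(k Phi) / eps) thresholds.  In particular
    the while loop starts from O(log(k Phi) / eps) instances, and since each
    iteration removes one of them, even its worst case, quadratic in their
    number, fits the update time. *)
Require Import Defs.
From HB Require Import structures.
From mathcomp Require Import all_boot all_order all_algebra.
From mathcomp Require Import reals exp.
From mathcomp Require Import sequences.
From mathcomp Require Import zify ring lra.

Set Implicit Arguments.
Unset Strict Implicit.
Unset Printing Implicit Defensive.

Import Order.TTheory GRing.Theory Num.Theory.
Local Open Scope ring_scope.

(** * Values and running times of traversals *)

Lemma traverse_val (A B : Type) (g : A -> timed B) (s : seq A) :
  (traverse g s).1 = [seq (g x).1 | x <- s].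
Proof. by elim: s => //= x s ->. Qed.

Lemma traverse_time_le (A B : Type) (g : A -> timed B) (P : pred A) (n : nat)
    (s : seq A) :
  (forall x, P x -> ((g x).2 <= n)%N) -> all P s ->
  ((traverse g s).2 <= size s * n)%N.
Proof.
move=> g_le; elim: s => //= x s IHs /andP[Px Ps].
by rewrite addn0 mulSn leq_add ?g_le ?IHs.
Qed.

(** * Bounds on a submodular function by its singletons *)

Section SetFunctionBounds.
Variables (R : realType) (V : finType) (f : {set V} -> R).
Hypothesis f_submod : submodular f.

(** By submodularity, deleting [x] from [S] costs at most the marginal of [x] at the empty set,
    hence at most [Delta f - f set0]; iterate over [S]. The term [f set0] stays because [f] need not
    be normalised. *)
Lemma submodular_le_card (S : {set V}) :
  f S <= f set0 + #|S|%:R * (Delta f - f set0).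
Proof.
have [n] := ubnP #|S|; elim: n S => // n IHn S ltSn.
have [->|[x xS]] := set_0Vmem S; first by rewrite cards0 mul0r addr0.
rewrite (cardsD1 x) xS add1n ltnS in ltSn.
have := IHn _ ltSn; have := f_submod (sub0set (S :\ x)) (negbT (setD11 x S)).
rewrite /marginal setD1K // setU0 (cardsD1 x S) xS natrD mulrDl mul1r.
have : f [set x] <= Delta f by exact: le_bigmax.
by lra.
Qed.

(** The bound from the cardinality becomes [k * Delta - (k - 1) * f set0]. The element [x] witnesses
    that [V] is inhabited, which gives [f set0 <= Delta f]. *)
Lemma submodular_le_k_Delta (k : nat) (S : {set V}) (x : V) :
  (forall A, 0 <= f A) -> monotone f -> (0 < k)%N -> (#|S| <= k)%N ->
  f S <= k%:R * Delta f.
Proof.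
move=> f_ge0 f_mono k_gt0 leSk; apply: le_trans (submodular_le_card S) _.
have f0_le : f set0 <= Delta f.
  by apply: le_trans (f_mono _ [set x] (sub0set _)) _; exact: le_bigmax.
have k_ge1 : 1 <= k%:R :> R by rewrite ler1n.
have : #|S|%:R * (Delta f - f set0) <= k%:R * (Delta f - f set0).
  by rewrite ler_wpM2r ?subr_ge0 // ler_nat.
have := f_ge0 set0; nra.
Qed.

Hypothesis f_gt0 : forall x, 0 < f [set x].

Lemma Delta_gt0 (x : V) : 0 < Delta f.
Proof. exact: lt_le_trans (f_gt0 x) (le_bigmax _ _ _). Qed.

Lemma min_singleton_le (x : V) : min_singleton f <= f [set x].
Proof. exact: bigmin_le. Qed.

Lemma min_singleton_gt0 (x : V) : 0 < min_singleton f.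
Proof. by apply: lt_bigmin => [|y _]; [exact: Delta_gt0 x | exact: f_gt0]. Qed.

Lemma Phi_ge1 (x : V) : 1 <= Phi f.
Proof.
rewrite /Phi ler_pdivlMr ?(min_singleton_gt0 x) // mul1r.
exact: le_trans (min_singleton_le x) (le_bigmax _ _ _).
Qed.

End SetFunctionBounds.

(** * Invariants and costs of a single thresholding instance *)

Section Thresholds.
Variables (R : realType) (V : finType) (f : {set V} -> R).
Variables (eval_time : {set V} -> nat) (k L : nat) (delta : R).
Hypothesis f_mono : monotone f.
Hypothesis f_gt0 : forall x, 0 < f [set x].
Hypothesis evalL : forall S, (eval_time S <= L)%N.

Local Notation feed := (sat_feed f eval_time k).
Local Notation feed1 := (sat_feed1 f eval_time k).
Local Notation new := (sat_new f eval_time k delta).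
Local Notation output := (sat_output f eval_time).

Definition bounded (N : nat) (c : candidates R V) : bool :=
  (size c <= N)%N && all (fun p : R * {set V} => #|p.2| <= k)%N c.

(** A certificate that the output is at least [d]. It survives later elements because candidate sets
    only grow and [f] is monotone. *)
Definition reaches (d : R) (c : candidates R V) : bool :=
  has (fun p => d <= f p.2) c.

Lemma feed1_card (u : V) (p : R * {set V}) :
  (#|p.2| <= k)%N -> (#|(feed1 u p).1.2| <= k)%N.
Proof.
rewrite /sat_feed1 /=; case: ifP => //= /andP[_ ltk] _.
by apply: leq_trans ltk; rewrite cardsU1; case: (_ \notin _).
Qed.

Lemma feed1_mono (u : V) (p : R * {set V}) : f p.2 <= f (feed1 u p).1.2.
Proof. by rewrite /sat_feed1 /=; case: ifP => //= _; rewrite f_mono ?subsetUr. Qed.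

Lemma feed1_time (u : V) (p : R * {set V}) : ((feed1 u p).2 <= 2 * L + 4)%N.
Proof.
rewrite /sat_feed1 /=; have := evalL (u |: p.2); have := evalL p.2.
by case: ifP => _ /=; lia.
Qed.

Lemma feed_bounded (N : nat) (u : V) (c : candidates R V) :
  bounded N c -> bounded N (feed u c).1.
Proof.
rewrite /bounded /sat_feed traverse_val size_map all_map => /andP[-> /= ck].
by apply: sub_all ck => p /=; exact: feed1_card.
Qed.

Lemma feed_reaches (d : R) (u : V) (c : candidates R V) :
  reaches d c -> reaches d (feed u c).1.
Proof.
rewrite /reaches /sat_feed traverse_val has_map; apply: sub_has => p /= dp.
exact: le_trans dp (feed1_mono u p).
Qed.

Lemma feed_time (N : nat) (u : V) (c : candidates R V) :
  bounded N c -> ((feed u c).2 <= N * (2 * L + 4))%N.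
Proof.
case/andP=> cN _; apply: leq_trans (leq_mul cN (leqnn _)).
apply: (@traverse_time_le _ _ _ predT); last exact: all_predT.
by move=> p _; exact: feed1_time.
Qed.

Lemma output_time (N : nat) (c : candidates R V) :
  bounded N c -> ((output c).2 <= N * L.+1)%N.
Proof.
case/andP=> cN _; apply: leq_trans (leq_mul cN (leqnn _)).
elim: c {cN} => //= p c IHc; have := evalL p.2; lia.
Qed.

Lemma output_ge (d : R) (c : candidates R V) : reaches d c -> d <= (output c).1.
Proof.
elim: c => //= p c IHc /orP[dp|/IHc dc]; rewrite le_max; first by rewrite dp.
by rewrite dc orbT.
Qed.

Lemma output_le (D : R) (c : candidates R V) :
  0 <= D -> all (fun p => f p.2 <= D) c -> (output c).1 <= D.
Proof.
by move=> D0; elim: c => //= p c IHc /andP[pD /IHc cD]; rewrite ge_max pD.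
Qed.

(* If u is rejected at the least threshold f [set u] / (2 * k), then
   f set0 > f [set u] / 2 already. *)
Lemma new_reaches (u : V) : (0 < k)%N ->
  reaches (f [set u] / 2) (feed u (new u).1).1.
Proof.
move=> k_gt0; rewrite /reaches /sat_feed traverse_val has_map /sat_new /= /sat_feed1 /=.
apply/orP; left; rewrite expr0 mul1r cards0 k_gt0 andbT setU0.
have fu := f_gt0 u; have k1 : 1 <= k%:R :> R by rewrite ler1n.
case: (leP (f [set u] / (2 * k%:R))) => /= h; first by lra.
have : f [set u] / (2 * k%:R) <= f [set u] / 2.
  by rewrite ler_wpM2l ?(ltW fu) // lef_pV2 ?posrE; lra.
by lra.
Qed.

Lemma new_bounded (N : nat) (u : V) :
  (Num.truncn (ln (2 * k%:R * Delta f / f [set u]) / ln (1 + delta)) < N)%N ->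
  bounded N (new u).1.
Proof.
move=> ltN; rewrite /bounded /sat_new /= size_map size_iota ltN /= cards0.
by rewrite all_map; apply/allP => j _ /=; rewrite cards0.
Qed.

Lemma new_time (N : nat) (u : V) :
  (Num.truncn (ln (2 * k%:R * Delta f / f [set u]) / ln (1 + delta)) < N)%N ->
  ((new u).2 <= L + N.+1)%N.
Proof. by rewrite /sat_new /= => ltN; have := evalL [set u]; lia. Qed.

End Thresholds.

(** * Expiry, the cost of pruning, and the number of survivors *)

Section Histogram.
Variables (R : realType) (V : finType).
Implicit Types s : seq (instance_out R V).

Lemma expire_all (P : pred (instance R V)) (W t : nat) (st : state R V) :
  all P st -> all P (expire W t st).1.
Proof.
elim: st => //= x [//|y st] IHst /andP[Px /IHst Pst] /=.
by move: Pst; case: ifP => //= _ ->; rewrite Px.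
Qed.

Lemma expire_size (W t : nat) (st : state R V) :
  (size (expire W t st).1 <= size st)%N.
Proof. by elim: st => //= x [//|y st] /=; case: ifP => _ /=; lia. Qed.

Lemma expire_time (W t : nat) (st : state R V) :
  ((expire W t st).2 <= 2 * size st)%N.
Proof. by elim: st => //= x [//|y st] /=; lia. Qed.

Lemma prune_all (P : pred (instance_out R V)) (beta : R) s s' n :
  prune beta s s' n -> all P s -> all P s'.
Proof.
elim=> // {}s {}s' s'' {}n [l [r [x [y [z [-> _ ->]]]]]] _ IH Ps; apply: IH.
by move: Ps; rewrite !all_cat /= => /and5P[-> -> _ -> ->].
Qed.

(** An iteration costs at most three times the current length and shortens the list by one, so the
    total is at most quadratic. *)
Lemma prune_time (beta : R) s s' n :
  prune beta s s' n -> (n <= 3 * size s ^ 2)%N.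
Proof.
elim=> [{}s _|{}s {}s' s'' {}n [l [r [x [y [z [-> _ ->]]]]]] _].
  by case: (size s) => [|m]; rewrite ?expnS ?expn0; nia.
by rewrite !size_cat /=; move: (size l) (size r) => a b; nia.
Qed.

Lemma prune_stuck (beta : R) s s' n : prune beta s s' n ->
  forall l r x y z, s' = l ++ [:: x, y, z & r] -> z.2 < (1 - beta) * x.2.
Proof.
elim=> // {n s'}s'' stuck l r x y z def.
rewrite ltNge; apply/negP => le_xz; apply: (stuck (l ++ [:: x, z & r])).
by exists l, r, x, y, z.
Qed.

(** Induction two instances at a time: passing from [x] to the instance two places later gains one
    factor [q], and the last instance reached still has output at least [d]. *)
Lemma geometric_decay (q d : R) s : 0 <= q ->
  (forall l r x y z, s = l ++ [:: x, y, z & r] -> z.2 < q * x.2) ->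
  all (fun x => d <= x.2) s ->
  forall x r, s = x :: r -> d <= q ^+ (size r)./2 * x.2.
Proof.
move=> q0; have [n] := ubnP (size s); elim: n s => // n IHn s ltsn decay ds.
move=> x [|y [|z r]] def_s; rewrite {}def_s /= in ltsn decay ds *.
- by case/andP: ds => dx _; rewrite expr0 mul1r.
- by case/and3P: ds => dx _ _; rewrite expr0 mul1r.
case/and3P: ds => _ _ dzr.
have := IHn (z :: r) _ _ dzr z r erefl; rewrite exprSr -mulrA => le_d.
apply: (le_trans (le_d _ _)) => [|l r' x' y' z' def|].
- by rewrite /=; lia.
- by apply: (decay (x :: y :: l) r' x' y' z'); rewrite def.
- by rewrite ler_wpM2l ?exprn_ge0 // ltW // (decay [::] r x y z).
Qed.

(** Since [1 - beta <= expR (- beta)], decay over [n] double steps gives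
    [d <= expR (- (n * beta)) * D]; take logarithms. The maximum with 0 covers the empty list, for
    which [d] and [D] need not be comparable. *)
Lemma size_decay (beta d D : R) s :
  0 <= beta <= 1 -> 0 < d ->
  (forall l r x y z, s = l ++ [:: x, y, z & r] -> z.2 < (1 - beta) * x.2) ->
  all (fun x => d <= x.2 <= D) s ->
  exists n, (size s <= 2 * n + 2)%N /\ n%:R * beta <= Num.max 0 (ln (D / d)).
Proof.
case: s => [|x r] /andP[beta0 beta1] d0 decay bnd.
  by exists 0%N; rewrite mul0r le_max lexx.
exists (size r)./2; split; first by rewrite /=; lia.
have dr : all (fun x => d <= x.2) (x :: r).
  by apply: sub_all bnd => y /andP[].
have q0 : 0 <= 1 - beta by rewrite subr_ge0.
have /(_ x r erefl) := geometric_decay q0 decay dr.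
case/andP: bnd => /andP[dx xD] _; set n := (size r)./2 => le_d.
have D0 : 0 < D by apply: lt_le_trans d0 (le_trans dx xD).
rewrite le_max; apply/orP; right.
rewrite -ler_expR lnK ?posrE ?divr_gt0 // ler_pdivlMr // -/n.
have le_exp : (1 - beta) ^+ n <= expR (- (n%:R * beta)).
  rewrite -mulrN expRM_natl lerXn2r ?nnegrE ?expR_ge0 //.
  exact: expR_ge1Dx.
apply: le_trans (_ : expR (n%:R * beta) * (expR (- (n%:R * beta)) * D) <= _).
  rewrite ler_wpM2l ?expR_ge0 //; apply: le_trans le_d _.
  by rewrite ler_pM ?exprn_ge0 // (le_trans (ltW d0)).
by rewrite mulrA -expRD subrr expR0 mul1r.
Qed.
End Histogram.

(** * The invariant of the algorithm and the cost of one update *)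

Section Update.
Variables (R : realType) (V : finType) (f : {set V} -> R).
Variables (eval_time : {set V} -> nat) (k L W N : nat) (beta delta : R).
Variable v : nat -> V.
Hypothesis f_ge0 : forall S, 0 <= f S.
Hypothesis f_mono : monotone f.
Hypothesis f_submod : submodular f.
Hypothesis f_gt0 : forall x, 0 < f [set x].
Hypothesis k_gt0 : (0 < k)%N.
Hypothesis L_gt0 : (0 < L)%N.
Hypothesis evalL : forall S, (eval_time S <= L)%N.
Hypothesis beta01 : 0 <= beta <= 1.

Local Notation d := (min_singleton f / 2).
Local Notation D := (k%:R * Delta f).

(** One number [N] serves for both counts: thresholds per instance here, and instances surviving the
    pruning in [decay_le]. *)
Hypothesis thresholds_lt : forall u : V,
  (Num.truncn (ln (2 * k%:R * Delta f / f [set u]) / ln (1 + delta)) < N)%N.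
Hypothesis decay_le : forall n : nat,
  n%:R * beta <= Num.max 0 (ln (D / d)) -> (2 * n + 2 <= N)%N.

Definition good (x : instance R V) : bool :=
  bounded k N x.2 && reaches f d x.2.

(* A new instance has only empty candidate sets, so that it becomes good only
   when [pass] feeds it its first element. *)
Definition good_after (t : nat) (x : instance R V) : bool :=
  bounded k N x.2 && reaches f d (sat_feed f eval_time k (v t) x.2).1.

(** Old instances keep their certificate when fed. The new one obtains it from its own first
    element, whose value is at least [min_singleton f]. *)
Lemma arrive_good (t : nat) (st : state R V) : all good st ->
  all (good_after t) (arrive f eval_time k delta v t st).1.
Proof.
move=> st_good; rewrite /arrive /= all_rcons; apply/andP; split.
  apply/andP; split; first exact: new_bounded (thresholds_lt _).
  have := new_reaches eval_time delta f_gt0 (v t) k_gt0.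
  apply: sub_has => p /=; apply: le_trans.
  by rewrite ler_pM2r ?invr_gt0 ?ltr0n // min_singleton_le.
apply: sub_all st_good => x /andP[xN xd]; apply/andP; split=> //.
exact: feed_reaches.
Qed.

Lemma pass_good (t : nat) (st : state R V) : all (good_after t) st ->
  all (fun y => good y.1 && (d <= y.2 <= D)) (pass f eval_time k v t st).1.
Proof.
rewrite /pass traverse_val all_map; apply: sub_all => x /andP[xN xd] /=.
have fN := feed_bounded f eval_time (v t) xN.
rewrite /good /= fN xd output_ge //=.
apply: output_le => //; first by rewrite mulr_ge0 ?(ltW (Delta_gt0 f_gt0 (v t))).
case/andP: fN => _; apply: sub_all => p /= pk.
exact: (submodular_le_k_Delta f_submod (v t) f_ge0 f_mono k_gt0 pk).
Qed.

(** Feeding costs [N * (2 * L + 4)] and the output [N * (L + 1)]; the sum is at most [8 * L * N]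
    because [L >= 1]. *)
Lemma pass_time (t : nat) (st : state R V) : all (good_after t) st ->
  ((pass f eval_time k v t st).2 <= size st * (8 * L * N))%N.
Proof.
apply: traverse_time_le => x /andP[xN _] /=.
have := feed_time f evalL (v t) xN.
have := output_time f evalL (feed_bounded f eval_time (v t) xN).
by nia.
Qed.

Lemma stored_le (n : nat) (st : state R V) :
  all (fun x => bounded k N x.2) st -> (size st <= n)%N ->
  (stored st <= n * N * k)%N.
Proof.
move=> stN ltn; rewrite -mulnA; apply: leq_trans (leq_mul ltn (leqnn _)).
rewrite /stored; elim: st stN {ltn} => [|x st IHst]; first by rewrite big_nil.
rewrite big_cons /= mulSn => /andP[/andP[xN xk] /IHst stN].
apply: leq_add => //; apply: leq_trans (leq_mul xN (leqnn _)).
elim: x.2 xk {xN stN} => [|p c IHc]; first by rewrite big_nil.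
by rewrite big_cons /= mulSn => /andP[pk /IHc ck]; exact: leq_add.
Qed.

(** Arrival may raise the number of instances to [N + 1]; pruning brings it back to [N], because the
    surviving outputs lie between [d] and [D] and decay geometrically. *)
Lemma update_good (t : nat) (st : state R V) (o : outcome R V) :
  all good st -> (size st <= N)%N ->
  update f eval_time k W beta delta v t st o ->
  [/\ all good (next_state o), (size (next_state o) <= N)%N,
      (update_time o <= 40 * L * N ^ 2)%N
    & (peak_memory o <= 2 * N ^ 2 * k)%N].
Proof.
move=> st_good leN; case=> pruned n arrived alive passed sol pr.
have N_gt0 : (0 < N)%N by exact: leq_ltn_trans (thresholds_lt (v t)).
have bnd_after s : all (good_after t) s -> all (fun x => bounded k N x.2) s.
  by apply: sub_all => x /andP[].
have arr_good : all (good_after t) arrived.1 by exact: arrive_good.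
have arr_size : (size arrived.1 <= N.+1)%N by rewrite /= size_rcons.
have alv_good : all (good_after t) alive.1 by exact: expire_all.
have alv_size : (size alive.1 <= N.+1)%N.
  exact: leq_trans (expire_size _ _ _) arr_size.
have pas_good := pass_good alv_good; rewrite -/passed in pas_good.
have pas_size : (size passed.1 <= N.+1)%N.
  by rewrite /passed /pass traverse_val size_map.
have prn_good := prune_all pr pas_good.
have prn_size : (size pruned <= N)%N.
  have d_gt0 : 0 < d by rewrite divr_gt0 ?ltr0n ?(min_singleton_gt0 f_gt0 (v t)).
  have := size_decay beta01 d_gt0 (prune_stuck pr) (D := D).
  case=> [|m [le_m /decay_le le_N]]; last exact: leq_trans le_m le_N.
  by apply: sub_all prn_good => y /andP[].
have next_good s : all (fun y : instance_out R V => good y.1 && (d <= y.2 <= D)) s ->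
    all good (map fst s).
  by rewrite all_map; apply: sub_all => y /andP[].
have bnd_good s : all good s -> all (fun x => bounded k N x.2) s.
  by apply: sub_all => x /andP[].
split; rewrite /next_state /update_time /peak_memory ?size_map //; first exact: next_good.
- have : (arrived.2 <= L + N.+1 + 1)%N.
    by have := new_time evalL (thresholds_lt (v t)); rewrite /=; lia.
  have : (alive.2 <= 2 * N.+1)%N.
    by apply: leq_trans (expire_time _ _ _) _; rewrite leq_mul2l.
  have : (passed.2 <= N.+1 * (8 * L * N))%N.
    by apply: leq_trans (pass_time alv_good) _; rewrite leq_mul2r alv_size orbT.
  have : (n <= 3 * N.+1 ^ 2)%N.
    by apply: leq_trans (prune_time pr) _; rewrite leq_mul2l leq_exp2r.
  have : (sol.2 <= 2)%N by rewrite /sol; case: (pruned).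
  move: arrived.2 alive.2 passed.2 sol.2 => a b c e le_e le_n le_c le_b le_a.
  (* Each monomial is bounded by [L * (N * N)], using [L, N >= 1], so the goal becomes linear in
     that product; the coefficients add up to 38. *)
  rewrite -mulnA; move: le_n; rewrite -!mulnn => le_n.
  have le_L : (L <= L * (N * N))%N by rewrite leq_pmulr // muln_gt0 N_gt0.
  have le_NN : (N * N <= L * (N * N))%N by rewrite leq_pmull.
  have le_N : (N <= N * N)%N by rewrite leq_pmulr.
  have le_LN : (L * N <= L * (N * N))%N by rewrite leq_mul2l le_N orbT.
  by clear - le_e le_n le_c le_b le_a le_L le_NN le_N le_LN N_gt0; lia.
- have leNN : (N.+1 * N * k <= 2 * N ^ 2 * k)%N by rewrite leq_mul2r; nia.
  have st_N (s : state R V) : all (fun x => bounded k N x.2) s -> (size s <= N.+1)%N ->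
      (stored s <= 2 * N ^ 2 * k)%N.
    by move=> sN /(stored_le sN)/leq_trans; apply.
  rewrite !geq_max; apply/and3P; split.
  - by apply/andP; split; apply: st_N; [exact: bnd_good|exact: leqW|exact: bnd_after|].
  - by apply: st_N; [exact: bnd_after|].
  - by apply/andP; split; apply: st_N; rewrite ?size_map ?(leqW prn_size) //;
      exact/bnd_good/next_good.
Qed.

Lemma run_good (t : nat) (st : state R V) :
  run f eval_time k W beta delta v t st -> all good st /\ (size st <= N)%N.
Proof.
elim=> // {}t {}st o _ [st_good st_size] upd.
by have [] := update_good st_good st_size upd.
Qed.

End Update.

(** * Elementary estimates of logarithms *)

Section Logarithms.
Variable R : realType.

Lemma ln_double_le (y : R) : 1 <= y -> ln (2 * y) <= 2 * Num.max 1 (ln y).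
Proof.
move=> y1; rewrite lnM ?posrE; [|lra|lra].
have : ln (1 + 1 : R) <= 1 by apply: le_ln1Dx; lra.
have : 1 <= Num.max 1 (ln y) by rewrite le_max lexx.
have : ln y <= Num.max 1 (ln y) by rewrite le_max lexx orbT.
have -> : 1 + 1 = 2 :> R by ring.
by lra.
Qed.

(** The inequality [ln (1 + y) <= y] at [y = - x / (1 + x)] gives [ln (1 + x) >= x / (1 + x)], and
    [1 + x <= 2]. *)
Lemma ln1D_ge (x : R) : 0 < x <= 1 -> x / 2 <= ln (1 + x).
Proof.
case/andP=> x0 x1.
have x1_gt0 : 0 < 1 + x by lra.
have def_inv : 1 + - (x / (1 + x)) = (1 + x)^-1.
  by field; rewrite gt_eqF.
have : x / 2 <= x / (1 + x).
  by rewrite ler_wpM2l ?(ltW x0) // lef_pV2 ?posrE //; lra.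
have : ln (1 + - (x / (1 + x))) <= - (x / (1 + x)).
  apply: le_ln1Dx; rewrite ltrN2 ltr_pdivrMr //; lra.
rewrite def_inv lnV ?posrE //; lra.
Qed.

End Logarithms.

(** * Choice of the constants and the final bounds *)

Theorem theorem2 (R : realType) :
  exists C : R, 0 < C /\
    forall (V : finType) (f : {set V} -> R) (eval_time : {set V} -> nat)
      (L k W : nat) (eps : R) (v : nat -> V),
      (forall S : {set V}, 0 <= f S) ->
      monotone f ->
      submodular f ->
      (forall x : V, 0 < f [set x]) ->
      (0 < k)%N ->
      (0 < W)%N ->
      0 < eps < 1 ->
      (0 < L)%N ->
      (forall S : {set V}, (eval_time S <= L)%N) ->
      forall (t : nat) (st : state R V) (o : outcome R V),
        run f eval_time k W (eps / 2) (eps / 2) v t st ->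
        update f eval_time k W (eps / 2) (eps / 2) v t.+1 st o ->
        (update_time o)%:R <=
          C * (L%:R * Num.max 1 (ln (k%:R * Phi f)) ^+ 2 / eps ^+ 2) /\
        (peak_memory o)%:R <=
          C * (k%:R * Num.max 1 (ln (k%:R * Phi f)) ^+ 2 / eps ^+ 2).
Proof.
(* The constant is the 40 of the update time times the 100 from [N ^ 2 <= 100 * (M / eps) ^ 2];
   memory needs only 200. *)
exists 4000; split=> [|V f eval_time L k W eps v f_ge0 f_mono f_submod f_gt0].
  by rewrite ltr0n.
move=> k_gt0 _ /andP[eps0 eps1] L_gt0 evalL t st o run_st upd.
have k1 : 1 <= k%:R :> R by rewrite ler1n.
have Phi1 : 1 <= Phi f := Phi_ge1 f_gt0 (v 0).
have min_gt0 := min_singleton_gt0 f_gt0 (v 0).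
have D_gt0 := Delta_gt0 f_gt0 (v 0).
have kPhi1 : 1 <= k%:R * Phi f by exact: mulr_ege1.
have ln_le := ln_double_le kPhi1.
set M := Num.max 1 (ln (k%:R * Phi f)) in ln_le *.
have M1 : 1 <= M by rewrite le_max lexx.
(* Both counts below are at most [8 * (M / eps)] plus 1 or 2, and [M / eps >= 1] absorbs the
   additive term. *)
set K := 10 * (M / eps).
have Me1 : 1 <= M / eps by rewrite ler_pdivlMr //; lra.
have K0 : 0 <= K by rewrite /K; lra.
pose N := Num.truncn K.
have N_le : N%:R <= K by rewrite truncn_le.
have thresholds_lt (u : V) :
  (Num.truncn (ln (2 * k%:R * Delta f / f [set u]) / ln (1 + eps / 2)) < N)%N.
  set x := ln _ / _.
  have x_ge : 1 <= 2 * k%:R * Delta f / f [set u].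
    rewrite ler_pdivlMr // mul1r; have : f [set u] <= Delta f by exact: le_bigmax.
    by nra.
  have x_le : ln (2 * k%:R * Delta f / f [set u]) <= 2 * M.
    apply: le_trans ln_le; rewrite ler_ln ?posrE; [|lra|lra].
    rewrite /Phi -!mulrA !ler_wpM2l ?ler0n ?(ltW D_gt0) //.
    by rewrite lef_pV2 ?posrE // min_singleton_le.
  have ln_eps : eps / 2 / 2 <= ln (1 + eps / 2) by apply: ln1D_ge; lra.
  have ln_gt0 : 0 < ln (1 + eps / 2) by lra.
  have x0 : 0 <= x by apply: divr_ge0; [exact: ln_ge0 | exact: ltW].
  have xK : x <= 8 * (M / eps).
    rewrite /x ler_pdivrMr //; apply: le_trans x_le _.
    (* The factor [eps / 4] is the lower bound for [ln (1 + eps / 2)]. *)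
    have -> : 2 * M = 8 * (M / eps) * (eps / 2 / 2) by field; rewrite gt_eqF.
    by rewrite ler_wpM2l //; lra.
  have tx : (Num.truncn x)%:R <= x by rewrite truncn_le.
  by rewrite truncn_ge_nat // -natr1 /K; lra.
have decay_le (n : nat) :
    n%:R * (eps / 2) <= Num.max 0 (ln (k%:R * Delta f / (min_singleton f / 2))) ->
    (2 * n + 2 <= N)%N.
  have -> : k%:R * Delta f / (min_singleton f / 2) = 2 * (k%:R * Phi f).
    by rewrite /Phi; field; rewrite gt_eqF.
  have -> : Num.max 0 (ln (2 * (k%:R * Phi f))) = ln (2 * (k%:R * Phi f)).
    by apply/max_idPr; rewrite ln_ge0 //; lra.
  move=> /le_trans/(_ ln_le) n_le; rewrite truncn_ge_nat // natrD natrM.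
  (* From [n * (eps / 2) <= 2 * M], so [2 * n + 2] is at most [K]. *)
  have : n%:R <= 4 * (M / eps) by rewrite mulrA ler_pdivlMr //; lra.
  by rewrite /K; lra.
have beta01 : 0 <= eps / 2 <= 1 by lra.
have [st_good st_size] := run_good f_ge0 f_mono f_submod f_gt0 k_gt0 L_gt0 evalL
  beta01 thresholds_lt decay_le run_st.
have [_ _ time_le mem_le] := update_good f_ge0 f_mono f_submod f_gt0 k_gt0 L_gt0
  evalL beta01 thresholds_lt decay_le st_good st_size upd.
have N2_le : N%:R ^+ 2 <= 100 * (M ^+ 2 / eps ^+ 2).
  have -> : 100 * (M ^+ 2 / eps ^+ 2) = K ^+ 2.
    by rewrite /K; field; rewrite gt_eqF.
  by rewrite lerXn2r ?nnegrE.
move: time_le mem_le; rewrite -2!(ler_nat R) !natrM => time_le mem_le.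
have L0 : 0 <= L%:R :> R by rewrite ler0n.
have M2e2 : 0 <= M ^+ 2 / eps ^+ 2 by rewrite divr_ge0 ?sqr_ge0.
rewrite -[L%:R * _ / _]mulrA -[k%:R * _ / _]mulrA.
by split; [apply: le_trans time_le _ | apply: le_trans mem_le _]; nra.
Qed.
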